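(* Let $n\ge 2$, let $K_1,\dots,K_n$ be convex sets in $\mathbb{R}^d$ and let $k\in[n]$. For $J\subseteq[n]$ let $K(J)=\bigcap_{j\in J}K_j$. If the closed Euclidean unit ball $B(b,1)$ centred at some $b\in\mathbb{R}^d$ intersects $K(J)$ for every $J\subseteq[n]$ with $|J|=k$, then there is a point $q\in\mathbb{R}^d$ such that \[ d(q,K_i)\le\sqrt{\frac{n-k}{k(n-1)}}\qquad\text{for all } i\in[n]. \]
   Context: $B(b,1)$ is the closed Euclidean ball of centre $b$ and radius $1$; $d(q,K)$ is the Euclidean distance from a point to a set; $[n]=\{1,\dots,n\}$. *)

(* Defs.v *)
From HB Require Import structures.
From mathcomp Require Import all_boot all_order all_algebra.
From mathcomp Require Import all_classical all_reals.
Set Implicit Arguments. Unset Strict Implicit. Unset Printing Implicit Defensive.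
Import Order.TTheory GRing.Theory Num.Theory.
Local Open Scope classical_set_scope.
Local Open Scope ring_scope.

Definition enorm (R : realType) (d : nat) (v : 'rV[R]_d) : R :=
  Num.sqrt (\sum_(i < d) v ord0 i ^+ 2).

Definition convex_set (R : realType) (d : nat) (K : set 'rV[R]_d) : Prop :=
  forall x y, K x -> K y -> forall t : R, 0 <= t -> t <= 1 ->
    K ((1 - t) *: x + t *: y).

Definition cball (R : realType) (d : nat) (b : 'rV[R]_d) (r : R) : set 'rV[R]_d :=
  [set x | enorm (x - b) <= r].

Definition Kint (R : realType) (d n : nat) (K : 'I_n -> set 'rV[R]_d)
  (J : {set 'I_n}) : set 'rV[R]_d :=
  [set x | forall j, j \in J -> K j x].

Definition edist (R : realType) (d : nat) (q : 'rV[R]_d) (K : set 'rV[R]_d) : R :=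
  inf [set enorm (q - x) | x in K].

(* Main.v *)
Require Import Defs.
From HB Require Import structures.
From mathcomp Require Import all_boot all_order all_algebra.
From mathcomp Require Import all_classical all_reals.
From mathcomp Require Import topology normedtype derive.
From mathcomp Require Import ring lra.
Set Implicit Arguments.
Unset Strict Implicit.
Unset Printing Implicit Defensive.
Import Order.TTheory GRing.Theory Num.Theory.
Import numFieldNormedType.Exports.
(* MathComp-Analysis has an unrelated [edist]. *)
Import Defs.
Local Open Scope ring_scope.

(* By compactness, choose points v_i with d(v_i, K_i) <= rho, where
   rho^2 = (n-k)/(k(n-1)), minimising the variance about their mean c.
   Optimality and the points of B(b,1) in the K(J) give vectors y_i = v_i - c,
   summing to 0, to which [dual_bound] applies; it forces y = 0, so q = c works.

   [dual_bound] is a Caratheodory theorem without dimension, in a form that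
   allows a linear term. For weights mu on points a_i let
   g(mu) = sum_i mu_i |a_i|^2 - |sum_i mu_i a_i|^2. Then for all weights lam and
   linear f there are weights mu supported on k points with
   f(mu) - g(mu) <= f(lam) - (1 - rho^2) g(lam). The factor 1 - rho^2 is a
   telescoping product, so it is enough to remove one point at a time, i.e. to
   find mu on a facet of the simplex with factor 1 - 1/(n-1)^2. On the simplex
   f - g is, up to a constant, the squared distance to a point x. Let w_l be the
   gradients of the barycentric coordinates, z = p - x the offset of
   p = sum_i lam_i a_i from x, and D = min_l xi_l / |w_l| the distance from x to
   the boundary, xi being the coordinates of x. Then
   (D^2 - |z|^2) |w_l|^2 <= xi_l^2 - <z,w_l>^2 = (xi_l - <z,w_l>) lam_l,
   and Cauchy-Schwarz with sum_l <a_l - p, w_l> = n - 1 yields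
   (n-1)^2 (D^2 - |z|^2) <= g(lam). *)

(** * The Euclidean inner product and Cauchy-Schwarz *)

Definition dot (R : realType) (d : nat) (u v : 'rV[R]_d) : R :=
  \sum_(i < d) u ord0 i * v ord0 i.

Section Dot.
Context {R : realType} {d : nat}.
Implicit Types (u v w : 'rV[R]_d) (a : R).

Lemma dotE u v : dot u v = (u *m v^T) ord0 ord0.
Proof. by rewrite mxE; apply: eq_bigr => i _; rewrite mxE. Qed.

Lemma dotC u v : dot u v = dot v u.
Proof. by apply: eq_bigr => i _; rewrite mulrC. Qed.

Lemma dotDl u v w : dot (u + v) w = dot u w + dot v w.
Proof. by rewrite !dotE mulmxDl mxE. Qed.

Lemma dotDr u v w : dot w (u + v) = dot w u + dot w v.
Proof. by rewrite dotC dotDl !(dotC w). Qed.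

Lemma dotZl a u v : dot (a *: u) v = a * dot u v.
Proof. by rewrite !dotE -scalemxAl mxE. Qed.

Lemma dotZr a u v : dot u (a *: v) = a * dot u v.
Proof. by rewrite dotC dotZl dotC. Qed.

Lemma dotNl u v : dot (- u) v = - dot u v.
Proof. by rewrite -scaleN1r dotZl mulN1r. Qed.

Lemma dotNr u v : dot u (- v) = - dot u v.
Proof. by rewrite dotC dotNl dotC. Qed.

Lemma dot0l v : dot 0 v = 0.
Proof. by rewrite -(scale0r 0) dotZl mul0r. Qed.

Lemma dot0r v : dot v 0 = 0.
Proof. by rewrite dotC dot0l. Qed.

Definition dot_lin := (dotDl, dotDr, dotNl, dotNr, dotZl, dotZr, dot0l, dot0r).

Lemma dot_suml I (r : seq I) (P : pred I) (F : I -> 'rV[R]_d) v :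
  dot (\sum_(i <- r | P i) F i) v = \sum_(i <- r | P i) dot (F i) v.
Proof.
by elim/big_rec2: _ => [|i y x _ <-]; rewrite ?dot0l ?dotDl.
Qed.

Lemma dot_ge0 v : 0 <= dot v v.
Proof. by apply: sumr_ge0 => i _; rewrite -expr2 sqr_ge0. Qed.

Lemma dot_eq0 v : (dot v v == 0) = (v == 0).
Proof.
apply/eqP/eqP => [v0|->]; last exact: dot0l.
have v2_ge0 (i : 'I_d) : true -> 0 <= v ord0 i * v ord0 i.
  by rewrite -expr2 sqr_ge0.
apply/rowP => i; rewrite mxE.
by have /eqP := psumr_eq0P v2_ge0 v0 (isT : xpredT i);
  rewrite mulf_eq0 orbb => /eqP.
Qed.

End Dot.

(** Cauchy-Schwarz without square roots. The product of [G i * H j] and [G j * H i] is at least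
    [(F i * F j) ^+ 2], so by AM-GM their sum is at least [F i * F j *+ 2]; summing over all pairs
    gives twice the claim. *)
Lemma sqr_sum_le (R : realType) (I : finType) (F G H : I -> R) :
    (forall i, 0 <= G i) -> (forall i, 0 <= H i) ->
    (forall i, F i ^+ 2 <= G i * H i) ->
  (\sum_i F i) ^+ 2 <= (\sum_i G i) * \sum_i H i.
Proof.
move=> G0 H0 FGH.
have FF i j : F i * F j *+ 2 <= G i * H j + G j * H i.
  have GH0 : 0 <= G i * H j + G j * H i by rewrite addr_ge0 ?mulr_ge0.
  rewrite -[leRHS](ger0_norm GH0); apply: le_trans (ler_norm _) _.
  rewrite -ler_sqr ?nnegrE ?normr_ge0// !real_normK ?num_real//.
  have : (F i ^+ 2) * (F j ^+ 2) <= (G i * H i) * (G j * H j).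
    by rewrite ler_pM ?sqr_ge0.
  have := sqr_ge0 (G i * H j - G j * H i).
  set a := G i; set b := G j; set c := H i; set e := H j.
  move=> h1 h2; rewrite -subr_ge0.
  have -> : (a * e + b * c) ^+ 2 - (F i * F j *+ 2) ^+ 2 =
    (a * e - b * c) ^+ 2 + 4 * ((a * c) * (b * e) - F i ^+ 2 * F j ^+ 2).
    by ring.
  by rewrite addr_ge0// mulr_ge0// subr_ge0.
rewrite -(ler_pMn2r (n := 2))// -subr_ge0.
have -> : (\sum_i G i) * (\sum_i H i) *+ 2 - (\sum_i F i) ^+ 2 *+ 2 =
    \sum_i \sum_j (G i * H j + G j * H i - F i * F j *+ 2).
  under [RHS]eq_bigr do rewrite sumrB big_split /= -mulr_sumr -mulr_suml.
  rewrite sumrB big_split /= -mulr_suml -mulr_sumr.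
  under [X in _ = _ - X]eq_bigr do rewrite sumrMnl -mulr_sumr.
  by rewrite sumrMnl -mulr_suml; ring.
by apply: sumr_ge0 => i _; apply: sumr_ge0 => j _; rewrite subr_ge0.
Qed.

Lemma dot_cauchy (R : realType) d (u v : 'rV[R]_d) :
  dot u v ^+ 2 <= dot u u * dot v v.
Proof.
apply: sqr_sum_le => i; rewrite -?expr2 ?sqr_ge0//.
by rewrite exprMn.
Qed.

(** * Row vectors as weights, and barycentric coordinates *)

Lemma mulmx_ones (R : realType) n (v : 'rV[R]_n) :
  v *m (const_mx 1 : 'cV_n) = (\sum_i v ord0 i)%:M.
Proof.
apply/matrixP => i j; rewrite !ord1 !mxE eqxx mulr1n.
by apply: eq_bigr => k _; rewrite mxE mulr1.
Qed.

Lemma mulmx_trE (R : realType) m d (z : 'rV[R]_d) (W : 'M[R]_(m, d)) l :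
  (z *m W^T) ord0 l = dot z (row l W).
Proof. by rewrite mxE; apply: eq_bigr => i _; rewrite !mxE. Qed.

Lemma sum_rowD (R : realType) n (u v : 'rV[R]_n) :
  \sum_i (u + v) ord0 i = \sum_i u ord0 i + \sum_i v ord0 i.
Proof. by rewrite -big_split; apply: eq_bigr => i _; rewrite mxE. Qed.

Lemma sum_rowZ (R : realType) n a (u : 'rV[R]_n) :
  \sum_i (a *: u) ord0 i = a * \sum_i u ord0 i.
Proof. by rewrite mulr_sumr; apply: eq_bigr => i _; rewrite mxE. Qed.

Lemma sum_rowN (R : realType) n (u : 'rV[R]_n) :
  \sum_i (- u) ord0 i = - \sum_i u ord0 i.
Proof. by rewrite -scaleN1r sum_rowZ mulN1r. Qed.

(* The rows of [W] are the gradients of the barycentric coordinates of the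
   simplex spanned by the rows of [A]. *)
Lemma barycentric_gradients (R : realType) n d (A : 'M[R]_(n, d))
    (lam : 'rV[R]_n) :
    (forall v : 'rV[R]_n, \sum_i v ord0 i = 0 -> v *m A = 0 -> v = 0) ->
    lam *m A = 0 -> \sum_i lam ord0 i = 1 ->
  exists W : 'M[R]_(n, d),
    [/\ forall v : 'rV[R]_n, \sum_i v ord0 i = 0 -> v *m A *m W^T = v,
        W *m W^T *m A = W
      & forall z : 'rV[R]_d, \sum_i (z *m W^T) ord0 i = 0].
Proof.
move=> indepA lamA lam1; pose u : 'cV[R]_n := const_mx 1.
have mulu (v : 'rV_n) : v *m u = (\sum_i v ord0 i)%:M by exact: mulmx_ones.
(* The Gram matrix of the rows of [A] with an extra coordinate 1 appended. Affine independence makes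
   it invertible, and [W] is its inverse times [A]. *)
pose T := A *m A^T + u *m u^T.
have trT : T^T = T by rewrite linearD /= !trmx_mul !trmxK.
have Tunit : T \in unitmx.
  rewrite -row_free_unit; apply: inj_row_free => v vT0.
  have : dot (v *m A) (v *m A) + (\sum_i v ord0 i) ^+ 2 = 0.
    have := congr1 (fun M : 'rV_n => (M *m v^T) ord0 ord0) vT0.
    rewrite mul0mx [RHS]mxE; apply: etrans.
    rewrite mulmxDr mulmxDl [RHS]mxE dotE; congr (_ + _).
      by rewrite trmx_mul !mulmxA.
    rewrite !mulmxA mulu -mulmxA -trmx_mul mulu tr_scalar_mx.
    by rewrite -scalar_mxM mxE eqxx mulr1n expr2.
  move=> /eqP; rewrite paddr_eq0 ?dot_ge0 ?sqr_ge0// dot_eq0 sqrf_eq0.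
  by move=> /andP[/eqP vA /eqP v0]; exact: indepA.
pose Y := invmx T.
have trY : Y^T = Y by rewrite trmx_inv trT.
have lamT : lam *m T = u^T.
  by rewrite mulmxDr !mulmxA lamA mul0mx add0r mulu lam1 mul1mx.
have uY : u^T *m Y = lam by rewrite -lamT mulmxK.
have Yu : Y *m u = lam^T by rewrite -uY trmx_mul trmxK trY.
pose W := Y *m A; have trW : W^T = A^T *m Y by rewrite trmx_mul trY.
exists W; split.
- move=> v v0; rewrite trW -[RHS](mulmxK Tunit) mulmxDr [v *m (u *m _)]mulmxA.
  by rewrite mulu v0 raddf0 mul0mx addr0 !mulmxA.
- have -> : W *m W^T *m A = Y *m (A *m A^T) *m (Y *m A).
    by rewrite trW /W !mulmxA.
  have -> : A *m A^T = T - u *m u^T by rewrite addrK.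
  rewrite mulmxBr mulVmx// mulmxBl mul1mx.
  have -> : Y *m (u *m u^T) *m (Y *m A) = Y *m u *m (u^T *m Y *m A).
    by rewrite !mulmxA.
  by rewrite uY lamA mulmx0 subr0.
- move=> z; have : z *m W^T *m u = 0.
    by rewrite trW -!mulmxA Yu -trmx_mul lamA trmx0 mulmx0.
  rewrite mulu => /(congr1 (fun M : 'M_1 => M ord0 ord0)).
  by rewrite !mxE eqxx mulr1n.
Qed.

(** * Variance on the simplex and the removal of one point *)

Definition in_simplex (R : realType) n (mu : 'rV[R]_n) : Prop :=
  (forall i, 0 <= mu ord0 i) /\ \sum_i mu ord0 i = 1.

(* [spread A mu] is the variance of the rows of [A] under the weights [mu]. *)
Definition spread (R : realType) n d (A : 'M[R]_(n, d)) (mu : 'rV[R]_n) : R :=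
  \sum_i mu ord0 i * dot (row i A) (row i A) - dot (mu *m A) (mu *m A).

(** The removal step with the mean of [lam] at the origin. By [phiD] the objective is a constant
    plus the squared distance from [mu *m A] to [- z], so a point of some facet close enough to
    [- z] is wanted. *)
Lemma facet_centered (R : realType) m d (A : 'M[R]_(m.+2, d))
    (lam f : 'rV[R]_m.+2) :
    (forall v : 'rV[R]_m.+2, \sum_i v ord0 i = 0 -> v *m A = 0 -> v = 0) ->
    lam *m A = 0 -> (forall i, 0 < lam ord0 i) -> \sum_i lam ord0 i = 1 ->
  exists l mu, [/\ in_simplex mu, mu ord0 l = 0 &
    dot f mu - spread A mu <=
      dot f lam - (1 - m.+1%:R ^- 2) * spread A lam].
Proof.
move=> indepA lamA lam_gt0 lam1.
have [W [AW WWA W1]] := barycentric_gradients indepA lamA lam1.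
pose w l := row l W.
pose e : 'rV[R]_m.+2 := f - \row_i dot (row i A) (row i A).
have phiE (mu : 'rV_m.+2) :
    dot f mu - spread A mu = dot e mu + dot (mu *m A) (mu *m A).
  rewrite /e dotDl dotNl /spread.
  have -> : \sum_i mu ord0 i * dot (row i A) (row i A) =
      dot (\row_i dot (row i A) (row i A)) mu.
    by rewrite [RHS]/dot; apply: eq_bigr => i _; rewrite mxE mulrC.
  by ring.
pose z := 2^-1 *: (e *m W).
pose zeta := z *m W^T.
have zeta0 : \sum_i zeta ord0 i = 0 by exact: W1.
have zetaE l : zeta ord0 l = dot z (w l) by exact: mulmx_trE.
have zetaA : zeta *m A = z.
  by rewrite /zeta /z -!scalemxAl -2!mulmxA [W *m _]mulmxA WWA.
have phiD (v : 'rV_m.+2) : \sum_i v ord0 i = 0 ->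
    dot f (lam + v) - spread A (lam + v) - (dot f lam - spread A lam) =
    dot (v *m A + z) (v *m A + z) - dot z z.
  move=> v0; rewrite !phiE mulmxDl lamA add0r dot0l addr0 dotDr.
  have -> : dot e v = 2 * dot (v *m A) z.
    rewrite /z dotZr mulrA divff ?pnatr_eq0// mul1r -{1}(AW v v0).
    by rewrite [RHS]dotC !dotE trmx_mul trmxK mulmxA.
  by rewrite !(dotDl, dotDr) (dotC z (v *m A)); ring.
pose s := spread A lam.
have sE : s = \sum_i lam ord0 i * dot (row i A) (row i A).
  by rewrite /s /spread lamA dot0l subr0.
have s0 : 0 <= s.
  by rewrite sE sumr_ge0// => i _; rewrite mulr_ge0 ?dot_ge0// ltW.
suff [l [v [v0 vl vge vle]]] : exists l (v : 'rV_m.+2),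
    [/\ \sum_i v ord0 i = 0, lam ord0 l + v ord0 l = 0,
        forall i, 0 <= lam ord0 i + v ord0 i &
        dot (v *m A + z) (v *m A + z) <= dot z z + m.+1%:R ^- 2 * s].
  exists l, (lam + v); split.
  - split=> [i|]; first by rewrite mxE.
    by rewrite sum_rowD v0 addr0.
  - by rewrite mxE.
  - have := phiD v v0; rewrite -/s mulrBl mul1r => phiv.
    by move: vle; rewrite -lerBlDl -phiv; move: (_ ^- 2 * s) => q; lra.
(* If some [zeta ord0 j >= lam ord0 j], then [- z] is not interior to the simplex. Walking from the
   origin towards [- z] meets a facet no later than [- z] itself, and the distance to [- z] does not
   grow. *)
have [zeta_lt|] := boolP [forall l, zeta ord0 l < lam ord0 l]; last first.
  rewrite negb_forall => /existsP[j]; rewrite -leNgt => lam_le.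
  have [l _ lmax] :=
    arg_maxP (fun l => zeta ord0 l / lam ord0 l) (erefl (xpredT j)).
  pose M := zeta ord0 l / lam ord0 l.
  have M1 : 1 <= M.
    by apply: le_trans (lmax j isT); rewrite ler_pdivlMr// mul1r.
  have M0 : 0 < M by apply: lt_le_trans M1.
  exists l, (- (M^-1 *: zeta)); split.
  - by rewrite sum_rowN sum_rowZ zeta0 mulr0 oppr0.
  - rewrite 2!mxE /M invf_div mulfVK ?subrr//.
    by apply/eqP => zl0; move: M0; rewrite /M zl0 mul0r ltxx.
  - move=> i; rewrite 2!mxE subr_ge0 mulrC ler_pdivrMr// mulrC -ler_pdivrMr//.
    exact: (lmax i isT).
  - rewrite mulNmx -scalemxAl zetaA -scaleN1r scalerA mulN1r.
    rewrite -[X in _ + X]scale1r -scalerDl dotZl dotZr mulrA -expr2.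
    apply: le_trans (_ : 1 * dot z z <= _); last first.
      by rewrite mul1r lerDl mulr_ge0// invr_ge0 exprn_ge0.
    rewrite ler_wpM2r ?dot_ge0// addrC expr_le1//.
      by rewrite gerBl invr_ge0 ltW.
    by rewrite subr_ge0 invf_le1.
move/forallP: zeta_lt => zeta_lt.
(* The barycentric coordinates of [- z], all positive in this case. *)
pose xi := lam - zeta.
have xiE i : xi ord0 i = lam ord0 i - zeta ord0 i by rewrite 2!mxE.
have xi_gt0 i : 0 < xi ord0 i by rewrite xiE subr_gt0.
have lam_lt1 l : lam ord0 l < 1.
  rewrite -lam1 (bigD1 l)//= ltrDl.
  have [j jl] : exists j : 'I_m.+2, j != l.
    have [->|l0] := eqVneq l ord0; first by exists ord_max.
    by exists ord0; rewrite eq_sym.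
  rewrite (bigD1 j)//= ltr_pwDl// sumr_ge0// => i _; exact: ltW.
have awE l : dot (row l A) (w l) = 1 - lam ord0 l.
  pose v : 'rV[R]_m.+2 := delta_mx 0 l - lam.
  have v0 : \sum_i v ord0 i = 0.
    rewrite /v; under eq_bigr do rewrite !mxE eqxx /=.
    rewrite sumrB lam1 (bigD1 l)//= eqxx big1 ?addr0 ?subrr// => i /negbTE ->.
    by [].
  have := congr1 (fun x : 'rV_m.+2 => x ord0 l) (AW v v0).
  by rewrite mulmx_trE mulmxBl lamA subr0 -rowE !mxE !eqxx.
have ww_gt0 l : 0 < dot (w l) (w l).
  rewrite lt_def dot_ge0 andbT; apply/negP; rewrite dot_eq0 => /eqP wl0.
  by have := awE l; rewrite wl0 dot0r => /esym/eqP; rewrite subr_eq0 gt_eqF.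
have [l _ lmin] :=
  arg_minP (fun l => xi ord0 l ^+ 2 / dot (w l) (w l))
    (erefl (xpredT (@ord0 m.+1))).
pose D2 := xi ord0 l ^+ 2 / dot (w l) (w l).
have D2xi i : D2 * dot (w i) (w i) <= xi ord0 i ^+ 2.
  by rewrite -ler_pdivlMr//; exact: lmin.
have D20 : 0 <= D2 by rewrite divr_ge0 ?sqr_ge0 ?dot_ge0.
pose kap := xi ord0 l / dot (w l) (w l).
have kap0 : 0 < kap by rewrite divr_gt0.
have kapE : kap ^+ 2 * dot (w l) (w l) = D2.
  by rewrite /kap /D2; field; rewrite gt_eqF.
have wwA : w l *m W^T *m A = w l.
  by rewrite /w -!row_mul WWA.
have entE i : (- zeta - kap *: (w l *m W^T)) ord0 i =
    - zeta ord0 i - kap * dot (w l) (w i).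
  have ent (a b : 'rV[R]_m.+2) : (- a - kap *: b) ord0 i =
      - a ord0 i - kap * b ord0 i by rewrite !mxE.
  by rewrite ent; congr (_ - _ * _); exact: mulmx_trE.
(* Go to [- z], then perpendicularly to its foot on the nearest facet [l]. The foot has nonnegative
   coordinates because no other facet is nearer. *)
exists l, (- zeta - kap *: (w l *m W^T)); split.
- by rewrite sum_rowD !sum_rowN sum_rowZ zeta0 W1 mulr0 oppr0 addr0.
- by rewrite entE addrA -xiE /kap mulfVK ?subrr// gt_eqF.
- move=> i; rewrite entE addrA -xiE subr_ge0.
  rewrite -[leRHS](ger0_norm (ltW (xi_gt0 i))); apply: le_trans (ler_norm _) _.
  rewrite -ler_sqr ?nnegrE ?normr_ge0// !real_normK ?num_real//.
  apply: le_trans (D2xi i); rewrite -kapE exprMn -mulrA.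
  by rewrite ler_wpM2l ?sqr_ge0// dot_cauchy.
- have -> : (- zeta - kap *: (w l *m W^T)) *m A + z = - kap *: w l.
    by rewrite mulmxBl mulNmx zetaA -scalemxAl wwA addrC addNKr scaleNr.
  rewrite dotZl dotZr mulrA mulrNN -expr2 kapE.
  have [D2z|zD2] := leP D2 (dot z z).
    by apply: le_trans D2z _; rewrite lerDl mulr_ge0// invr_ge0 exprn_ge0.
  pose c := D2 - dot z z; have c0 : 0 < c by rewrite subr_gt0.
  (* Since [lam = xi + zeta], this is the cofactor of [lam] in the difference of the squares of [xi]
     and [zeta]. It sums to 1. *)
  pose h i := xi ord0 i - zeta ord0 i.
  have wwh i : c * dot (w i) (w i) <= lam ord0 i * h i.
    have -> : lam ord0 i * h i = xi ord0 i ^+ 2 - zeta ord0 i ^+ 2.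
      by rewrite /h xiE; ring.
    rewrite /c mulrBl lerB ?D2xi//.
    by rewrite zetaE dot_cauchy.
  have h0 i : 0 <= h i.
    rewrite -(pmulr_rge0 _ (lam_gt0 i)); apply: le_trans (wwh i).
    by rewrite mulr_ge0 ?dot_ge0// ltW.
  have : (\sum_i dot (row i A) (w i)) ^+ 2 <=
      (\sum_i lam ord0 i * dot (row i A) (row i A)) * \sum_i (c^-1 * h i).
    apply: sqr_sum_le => i.
    - by rewrite mulr_ge0 ?dot_ge0// ltW.
    - by rewrite mulr_ge0// invr_ge0 ltW.
    - apply: le_trans (dot_cauchy _ _) _.
      have -> : lam ord0 i * dot (row i A) (row i A) * (c^-1 * h i) =
        dot (row i A) (row i A) * (c^-1 * (lam ord0 i * h i)) by ring.
      by rewrite ler_wpM2l ?dot_ge0// ler_pdivlMl.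
  under eq_bigr do rewrite awE.
  rewrite -sE -mulr_sumr sumrB lam1 sumr_const card_ord -(natrB _ (ltn0Sn _)).
  have -> : \sum_i h i = 1.
    rewrite sumrB zeta0 subr0; under eq_bigr do rewrite xiE.
    by rewrite sumrB lam1 zeta0 subr0.
  rewrite subn1 mulr1 ler_pdivlMr// => mcs.
  by rewrite -lerBlDl -/c ler_pdivlMl// exprn_gt0.
Qed.

Lemma spread_translate (R : realType) n d (A : 'M[R]_(n, d)) (p : 'rV[R]_d)
    (mu : 'rV[R]_n) :
  \sum_i mu ord0 i = 1 -> spread (A - const_mx 1 *m p) mu = spread A mu.
Proof.
move=> mu1; set B := A - _.
have rowB i : row i B = row i A - p.
  rewrite linearB /=; congr (_ - _); apply/rowP => j.
  by rewrite !mxE big_ord1 mxE mul1r.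
have muB : mu *m B = mu *m A - p.
  by rewrite mulmxBr mulmxA mulmx_ones mu1 mul1mx.
rewrite /spread muB.
under eq_bigr do rewrite rowB.
have -> : \sum_i mu ord0 i * dot (row i A - p) (row i A - p) =
    \sum_i mu ord0 i * dot (row i A) (row i A) - 2 * dot (mu *m A) p + dot p p.
  have pp : \sum_i mu ord0 i * dot p p = dot p p.
    by rewrite -mulr_suml mu1 mul1r.
  rewrite mulmx_sum_row dot_suml mulr_sumr -pp -sumrB -big_split.
  apply: eq_bigr => i _ /=.
  by rewrite !dot_lin (dotC p (row i A)); ring.
by rewrite !dot_lin (dotC p (mu *m A)); ring.
Qed.

(** Taking the weighted mean as origin kills the subtracted term. *)
Lemma spread_ge0 (R : realType) n d (A : 'M[R]_(n, d)) (mu : 'rV[R]_n) :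
  in_simplex mu -> 0 <= spread A mu.
Proof.
move=> [mu0 mu1]; rewrite -(spread_translate A (mu *m A) mu1) /spread.
rewrite mulmxBr [mu *m (_ *m _)]mulmxA mulmx_ones mu1 mul1mx subrr dot0l subr0.
by apply: sumr_ge0 => i _; rewrite mulr_ge0 ?dot_ge0.
Qed.

(** A vanishing weight already puts [lam] on a facet. Otherwise a translation reduces to
    [facet_centered]. *)
Lemma facet_point (R : realType) m d (A : 'M[R]_(m.+2, d))
    (lam f : 'rV[R]_m.+2) :
    (forall v : 'rV[R]_m.+2, \sum_i v ord0 i = 0 -> v *m A = 0 -> v = 0) ->
    in_simplex lam ->
  exists l mu, [/\ in_simplex mu, mu ord0 l = 0 &
    dot f mu - spread A mu <=
      dot f lam - (1 - m.+1%:R ^- 2) * spread A lam].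
Proof.
move=> indepA [lam0 lam1].
have [lam_gt0|] := boolP [forall i, 0 < lam ord0 i]; last first.
  rewrite negb_forall => /existsP[l]; rewrite -leNgt => laml.
  exists l, lam; split=> //; first by apply/le_anti; rewrite laml lam0.
  rewrite lerB// ler_piMl ?spread_ge0// gerBl.
  by rewrite invr_ge0 exprn_ge0.
pose B := A - const_mx 1 *m (lam *m A).
have mulB (v : 'rV_m.+2) :
    v *m B = v *m A - (\sum_i v ord0 i)%:M *m (lam *m A).
  by rewrite mulmxBr [v *m (_ *m _)]mulmxA mulmx_ones.
have [||||l [mu [mus mul ineq]]] := @facet_centered _ _ _ B lam f.
- by move=> v v0; rewrite mulB v0 raddf0 mul0mx subr0; exact: indepA.
- by rewrite mulB lam1 mul1mx subrr.
- exact/forallP.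
- exact: lam1.
exists l, mu; split=> //.
by move: ineq; rewrite !spread_translate// mus.2.
Qed.

(** * Extending weights from a facet to the whole simplex *)

Definition row_ext (R : realType) n (l : 'I_n.+1) (nu : 'rV[R]_n) :
    'rV[R]_n.+1 :=
  \row_i oapp (fun j => nu ord0 j) 0 (unlift l i).

Section RowExt.
Context {R : realType} {n : nat} (l : 'I_n.+1).
Implicit Type nu : 'rV[R]_n.

Lemma row_ext_hole nu : row_ext l nu ord0 l = 0.
Proof. by rewrite mxE unlift_none. Qed.

Lemma row_ext_lift nu j : row_ext l nu ord0 (lift l j) = nu ord0 j.
Proof. by rewrite mxE liftK. Qed.

Lemma row_ext_col' (mu : 'rV[R]_n.+1) :
  mu ord0 l = 0 -> row_ext l (col' l mu) = mu.
Proof.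
move=> mul; apply/rowP => i; have [j ->|->] := unliftP l i.
  by rewrite row_ext_lift mxE.
by rewrite row_ext_hole.
Qed.

Lemma sum_row_ext (F : 'I_n.+1 -> R) nu :
  \sum_i row_ext l nu ord0 i * F i = \sum_j nu ord0 j * F (lift l j).
Proof.
rewrite (bigD1_ord l)//= row_ext_hole mul0r add0r.
by apply: eq_bigr => j _; rewrite row_ext_lift.
Qed.

Lemma row_ext_sum1 nu : \sum_i row_ext l nu ord0 i = \sum_j nu ord0 j.
Proof.
under eq_bigr do rewrite -[row_ext _ _ _ _]mulr1.
by rewrite sum_row_ext; under eq_bigr do rewrite mulr1.
Qed.

Lemma row_ext_mulmx d (A : 'M[R]_(n.+1, d)) nu :
  row_ext l nu *m A = nu *m row' l A.
Proof.
apply/rowP => k; rewrite !mxE (sum_row_ext (fun i => A i k)).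
by apply: eq_bigr => j _; rewrite mxE.
Qed.

Lemma row_ext_dot (f : 'rV[R]_n.+1) nu :
  dot f (row_ext l nu) = dot (col' l f) nu.
Proof.
rewrite dotC [LHS]sum_row_ext dotC.
by apply: eq_bigr => j _; rewrite mxE.
Qed.

Lemma row_ext_spread d (A : 'M[R]_(n.+1, d)) nu :
  spread A (row_ext l nu) = spread (row' l A) nu.
Proof.
rewrite /spread row_ext_mulmx; congr (_ - _).
rewrite (sum_row_ext (fun i => dot (row i A) (row i A))).
apply: eq_bigr => j _; congr (_ * _).
suff -> : row (lift l j) A = row j (row' l A) by [].
by apply/rowP => k; rewrite !mxE.
Qed.

Lemma row_ext_simplex nu : in_simplex (row_ext l nu) <-> in_simplex nu.
Proof.
split=> -[nu0 nu1]; (split; last by rewrite -nu1 row_ext_sum1).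
  by move=> j; have := nu0 (lift l j); rewrite row_ext_lift.
move=> i; have [j ->|->] := unliftP l i; first by rewrite row_ext_lift.
by rewrite row_ext_hole.
Qed.

Lemma row_ext_support nu :
  (#|[set i | row_ext l nu ord0 i != 0%R]| <= #|[set j | nu ord0 j != 0%R]|)%N.
Proof.
apply: leq_trans (leq_imset_card (lift l) _).
apply/subset_leq_card/fintype.subsetP => i.
have [j ->|->] := unliftP l i; rewrite inE; last by rewrite row_ext_hole eqxx.
by rewrite row_ext_lift => nuj; apply: imset_f; rewrite inE.
Qed.

End RowExt.

(** * The constant and its telescoping product *)

Definition radius2 (R : realType) (n k : nat) : R :=
  (n - k)%:R / (k * (n - 1))%:R.

Lemma radius2_ge0 (R : realType) n k : 0 <= radius2 R n k.
Proof. by rewrite divr_ge0 ?ler0n. Qed.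

Lemma radius2_le1 (R : realType) n k : (0 < k)%N -> radius2 R n k <= 1.
Proof.
move=> k0; rewrite /radius2; have [n1|n1] := leqP n 1.
  (* The denominator is 0 here, and the inverse of 0 is 0. *)
  by rewrite (eqP n1) muln0 invr0 mulr0 ler01.
rewrite ler_pdivrMr ?ltr0n ?muln_gt0 ?k0 ?subn_gt0// mul1r ler_nat.
by rewrite (leq_trans (leq_sub2l _ k0))// leq_pmull.
Qed.

Lemma radius2_lt1 (R : realType) n k :
  (1 < k)%N -> (k <= n)%N -> radius2 R n k < 1.
Proof.
move=> k1 kn; have n1 := leq_trans k1 kn.
rewrite /radius2 ltr_pdivrMr ?ltr0n ?muln_gt0 ?subn_gt0 ?n1 ?(ltnW k1)//.
rewrite mul1r ltr_nat (@leq_trans (1 * (n - 1)).+1)//.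
  by rewrite mul1n ltnS leq_sub2l// ltnW.
by rewrite ltn_pmul2r ?subn_gt0.
Qed.

(** In closed form [1 - radius2 R n k] is n(k-1)/(k(n-1)). The ratio of its values at m+2 and m+1 is
    m(m+2)/(m+1)^2, which is the factor lost in [facet_point]. *)
Lemma radius2_step (R : realType) m k : (1 < k)%N -> (k <= m.+1)%N ->
  1 - radius2 R m.+2 k = (1 - m.+1%:R ^- 2) * (1 - radius2 R m.+1 k).
Proof.
move=> k1 km; rewrite /radius2 !natrM !subSS !subn0.
rewrite (natrB _ (leqW km)) (natrB _ km) -addn2 -addn1 !natrD.
have m0 : (m%:R : R) != 0 by rewrite pnatr_eq0 -lt0n -ltnS (leq_trans k1).
have k0 : (k%:R : R) != 0 by rewrite pnatr_eq0 -lt0n ltnW.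
have m1 : (m%:R + 1 : R) != 0 by rewrite natr1 pnatr_eq0.
by field; rewrite m0 k0 addrC m1.
Qed.

(** * Weights supported on few points *)

(** Induction on the number of points: [facet_point] drops one, and the losses multiply as in
    [radius2_step]. With at most [k] points left, [lam] itself serves. *)
Lemma sparse_point (R : realType) d k m (A : 'M[R]_(m.+1, d))
    (lam f : 'rV[R]_m.+1) :
    (0 < k)%N -> (k <= m.+1)%N ->
    (forall v : 'rV[R]_m.+1, \sum_i v ord0 i = 0 -> v *m A = 0 -> v = 0) ->
    in_simplex lam ->
  exists mu, [/\ in_simplex mu, (#|[set i | mu ord0 i != 0%R]| <= k)%N &
    dot f mu - spread A mu <=
      dot f lam - (1 - radius2 R m.+1 k) * spread A lam].
Proof.
move=> k0; elim: m A lam f => [|m IH] A lam f km indepA lams.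
  exists lam; split=> //.
    by rewrite (leq_trans (max_card _))// card_ord.
  by rewrite lerB// ler_piMl ?spread_ge0// gerBl radius2_ge0.
move: km; rewrite leq_eqVlt => /predU1P[k_eq|]; last rewrite ltnS => km.
  exists lam; split=> //.
    by rewrite (leq_trans (max_card _))// card_ord k_eq.
  by rewrite lerB// ler_piMl ?spread_ge0// gerBl radius2_ge0.
have [k1|] := leqP k 1; last first.
  move=> k1; pose c := 1 - radius2 R m.+1 k.
  have c0 : 0 < c by rewrite subr_gt0 radius2_lt1.
  (* The induction hypothesis bounds by [dot f mu - c * spread A mu]. Rescaling [f] by [c^-1] turns
     this into [c] times the objective of [facet_point]. *)
  have [l [mu [mus mul ineq]]] := facet_point (c^-1 *: f) indepA lams.
  have muE := row_ext_col' mul.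
  have [|||nu [nus nuk nuineq]] := IH (row' l A) (col' l mu) (col' l f).
  - by [].
  - move=> v v0 vA; have : row_ext l v = 0.
      by apply: indepA; rewrite ?row_ext_sum1 ?row_ext_mulmx.
    move=> ev; apply/rowP => j.
    by rewrite -(row_ext_lift l) ev !mxE.
  - by rewrite -(row_ext_simplex l) muE.
  exists (row_ext l nu); split.
  - by rewrite row_ext_simplex.
  - exact: leq_trans (row_ext_support _ _) nuk.
  rewrite row_ext_dot row_ext_spread; apply: le_trans nuineq _.
  rewrite -row_ext_dot -row_ext_spread muE radius2_step// -/c.
  rewrite !dotZl in ineq.
  have -> : dot f mu - c * spread A mu = c * (c^-1 * dot f mu - spread A mu).
    by rewrite [RHS]mulrBr mulVKf// gt_eqF.
  have -> : dot f lam - (1 - m.+1%:R ^- 2) * c * spread A lam =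
      c * (c^-1 * dot f lam - (1 - m.+1%:R ^- 2) * spread A lam).
    by rewrite [RHS]mulrBr mulVKf ?gt_eqF// mulrCA mulrA.
  by rewrite ler_wpM2l// ltW.
have {k1}k1 : k = 1%N by apply/eqP; rewrite eqn_leq k1.
(* For [k = 1] the factor of the spread is 0. A vertex minimising [f] has spread 0 and does at least
   as well as the average of [f] under [lam]. *)
have [j _ jmin] := arg_minP (fun j => f ord0 j) (erefl (xpredT (@ord0 m.+1))).
exists (delta_mx 0 j); split.
- split=> [i|]; first by rewrite mxE; case: (_ && _).
  rewrite (bigD1 j)//= mxE !eqxx big1 ?addr0// => i /negbTE ij.
  by rewrite mxE ij andbF.
- rewrite k1; apply: leq_trans (_ : #|[set j]| <= _)%N; last by rewrite cards1.
  apply: subset_leq_card; apply/fintype.subsetP => i.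
  by rewrite !inE mxE; case: (i == j); rewrite ?andbF ?eqxx.
have dot_delta (g : 'rV[R]_m.+2) : dot g (delta_mx 0 j) = g ord0 j.
  rewrite /dot (bigD1 j)//= mxE !eqxx mulr1 big1 ?addr0// => i /negbTE ij.
  by rewrite mxE ij andbF mulr0.
have -> : spread A (delta_mx 0 j) = 0.
  rewrite /spread -rowE (bigD1 j)//= mxE !eqxx mul1r big1 ?addr0 ?subrr//.
  by move=> i /negbTE ij; rewrite mxE ij andbF mul0r.
rewrite k1 /radius2 mul1n divff ?pnatr_eq0// subrr mul0r !subr0 dot_delta.
rewrite -[leLHS]mul1r -lams.2 mulr_suml dotC.
by apply: ler_sum => i _; rewrite ler_wpM2l ?lams.1//; exact: jmin.
Qed.

Lemma dot_row_mx (R : realType) m n (u u' : 'rV[R]_m) (v v' : 'rV[R]_n) :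
  dot (row_mx u v) (row_mx u' v') = dot u u' + dot v v'.
Proof. by rewrite !dotE tr_row_mx mul_row_col mxE. Qed.

(* Appending [e] times the identity to the rows of [A] makes them linearly
   independent and changes the spread by at most [e ^+ 2]. *)
Lemma sparse_point_approx (R : realType) d k m (A : 'M[R]_(m.+1, d))
    (lam f : 'rV[R]_m.+1) (delta : R) :
    (0 < k)%N -> (k <= m.+1)%N -> in_simplex lam -> 0 < delta ->
  exists mu, [/\ in_simplex mu, (#|[set i | mu ord0 i != 0%R]| <= k)%N &
    dot f mu - spread A mu <=
      dot f lam - (1 - radius2 R m.+1 k) * spread A lam + delta].
Proof.
move=> k0 km lams delta0; pose e := Num.sqrt delta.
have e2 : e ^+ 2 = delta by rewrite sqr_sqrtr// ltW.
pose B := row_mx A (e%:M : 'M[R]_m.+1).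
have mulB (v : 'rV_m.+1) : v *m B = row_mx (v *m A) (e *: v).
  by rewrite mul_mx_row mul_mx_scalar.
have rowB i : dot (row i B) (row i B) = dot (row i A) (row i A) + delta.
  rewrite row_row_mx dot_row_mx -scalemx1 linearZ /= row1 dotZl dotZr mulrA.
  rewrite -expr2 e2; congr (_ + _); rewrite -[RHS]mulr1; congr (_ * _).
  rewrite /dot (bigD1 i)//= mxE !eqxx mulr1 big1 ?addr0// => j /negbTE ji.
  by rewrite mxE ji andbF mulr0.
have spreadB (mu : 'rV_m.+1) : in_simplex mu ->
    spread B mu = spread A mu + delta * (1 - dot mu mu).
  move=> [_ mu1]; rewrite /spread mulB dot_row_mx dotZl dotZr mulrA -expr2 e2.
  under eq_bigr do rewrite rowB mulrDr.
  by rewrite big_split /= -mulr_suml mu1; ring.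
have indepB (v : 'rV_m.+1) : \sum_i v ord0 i = 0 -> v *m B = 0 -> v = 0.
  move=> _ /eqP; rewrite mulB row_mx_eq0 => /andP[_].
  by rewrite scaler_eq0 gt_eqF ?sqrtr_gt0// => /eqP.
have [mu [mus muk ineq]] := sparse_point f k0 km indepB lams.
exists mu; split=> //.
have dot_le1 (nu : 'rV_m.+1) : in_simplex nu -> dot nu nu <= 1.
  move=> [nu0 nu1]; rewrite -nu1; apply: ler_sum => i _.
  rewrite ler_piMl//; rewrite -nu1 (bigD1 i)//= lerDl sumr_ge0//.
move: ineq; rewrite !spreadB// => ineq.
have := mulr_ge0 (ltW delta0) (dot_ge0 mu).
have : 0 <= (1 - radius2 R m.+1 k) * (delta * (1 - dot lam lam)).
  by rewrite !mulr_ge0 ?subr_ge0 ?radius2_le1 ?dot_le1// ltW.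
have E : delta * (1 - dot mu mu) = delta - delta * dot mu mu by ring.
move: ineq; rewrite E mulrDr; move: (_ * (delta * _)) (_ * spread A lam).
by move: (delta * _) (spread A mu) => *; lra.
Qed.

(** * The Euclidean norm *)

Section Enorm.
Context {R : realType} {d : nat}.
Implicit Types u v : 'rV[R]_d.

Lemma enorm_ge0 v : 0 <= enorm v. Proof. exact: sqrtr_ge0. Qed.

Lemma sqr_enorm v : enorm v ^+ 2 = dot v v.
Proof.
have -> : enorm v = Num.sqrt (dot v v).
  by rewrite /enorm /dot; under eq_bigr do rewrite expr2.
by rewrite sqr_sqrtr ?dot_ge0.
Qed.

Lemma enorm_le (a : R) v : 0 <= a -> (enorm v <= a) = (dot v v <= a ^+ 2).
Proof. by move=> a0; rewrite -ler_sqr ?nnegrE ?enorm_ge0// sqr_enorm. Qed.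

Lemma enorm_eq0 v : (enorm v == 0) = (v == 0).
Proof. by rewrite -sqrf_eq0 sqr_enorm dot_eq0. Qed.

Lemma enorm0 : enorm (0 : 'rV[R]_d) = 0.
Proof. by apply/eqP; rewrite enorm_eq0. Qed.

Lemma dot_le_enorm u v : dot u v <= enorm u * enorm v.
Proof.
apply: le_trans (ler_norm _) _.
rewrite -ler_sqr ?nnegrE ?mulr_ge0 ?enorm_ge0// real_normK ?num_real//.
by rewrite exprMn !sqr_enorm dot_cauchy.
Qed.

Lemma enormZ a v : enorm (a *: v) = `|a| * enorm v.
Proof.
apply/eqP; rewrite -(@eqrXn2 _ 2) ?mulr_ge0 ?enorm_ge0//.
by rewrite exprMn !sqr_enorm real_normK ?num_real// dotZl dotZr mulrA -expr2.
Qed.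

Lemma enormD u v : enorm (u + v) <= enorm u + enorm v.
Proof.
rewrite enorm_le ?addr_ge0 ?enorm_ge0// !(dotDl, dotDr) (dotC v u).
have := dot_le_enorm u v; rewrite sqrrD !sqr_enorm; lra.
Qed.

End Enorm.

(** * The dual inequality *)

(** Supports have at most [k] elements, while the points [p J] are controlled for sets of size
    exactly [k]. *)
Lemma card_superset (T : finType) (S : {set T}) k :
  (#|S| <= k)%N -> (k <= #|T|)%N -> exists2 J : {set T}, S \subset J & #|J| = k.
Proof.
move=> Sk kT; pose B := [set x in take (k - #|S|) (enum (~: S))].
have BS : B \subset ~: S.
  by apply/fintype.subsetP => x; rewrite !inE => /mem_take;
    rewrite mem_enum !inE.
exists (S :|: B); first exact: finset.subsetUl.
rewrite cardsU; have -> : S :&: B = finset.set0.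
  by apply/eqP; rewrite finset.setIC finset.setI_eq0 finset.disjoints_subset.
rewrite finset.cards0 subn0 cardsE (card_uniqP _) ?take_uniq ?enum_uniq//.
by rewrite size_takel ?subnKC// -cardE leq_subLR cardsC.
Qed.

(** Weight the unit vectors along the [y i] by their lengths: the mean is 0 and the spread 1. Sparse
    weights [mu] live on one [J], where the single point [p J] bounds all the [h i] involved; the
    spread inequality carries that bound back to all indices. *)
Lemma dual_bound (R : realType) d n k (y : 'I_n.+1 -> 'rV[R]_d)
    (p : {set 'I_n.+1} -> 'rV[R]_d) (b : 'rV[R]_d) (h : 'I_n.+1 -> R) :
    (0 < k)%N -> (k <= n.+1)%N -> \sum_i y i = 0 ->
    (forall J : {set 'I_n.+1}, #|J| = k -> enorm (p J - b) <= 1) ->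
    (forall (J : {set 'I_n.+1}) i, #|J| = k -> i \in J ->
      h i <= dot (y i) (p J)) ->
  \sum_i h i <= Num.sqrt (radius2 R n.+1 k) * \sum_i enorm (y i).
Proof.
move=> k0 kn y0 pb hp; set rho := Num.sqrt _; set L := \sum_i enorm (y i).
have rho0 : 0 <= rho by exact: sqrtr_ge0.
have rho2 : rho ^+ 2 = radius2 R n.+1 k by rewrite sqr_sqrtr ?radius2_ge0.
have h_le0 i : y i = 0 -> h i <= 0.
  move=> yi0; have [||J] := @card_superset _ [set i] k.
  - by rewrite cards1.
  - by rewrite card_ord.
  by rewrite finset.sub1set => iJ Jk; have := hp J i Jk iJ; rewrite yi0 dot0l.
have L0 : 0 <= L by apply: sumr_ge0 => i _; exact: enorm_ge0.
have [L_eq0|Lneq0] := eqVneq L 0.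
  rewrite L_eq0 mulr0; apply: sumr_le0 => i _; apply: h_le0.
  apply/eqP; rewrite -enorm_eq0; apply/eqP.
  by move: (i) isT; apply: psumr_eq0P => // j _; exact: enorm_ge0.
have {Lneq0}L0 : 0 < L by rewrite lt_def Lneq0.
(* If [y i = 0], the row of [A], the weight and [D i] below are all 0, the inverse of 0 being 0;
   such indices are covered by [h_le0]. *)
pose lam : 'rV[R]_n.+1 := \row_i (enorm (y i) / L).
have lams : in_simplex lam.
  split=> [i|]; first by rewrite mxE divr_ge0 ?enorm_ge0 ?ltW.
  by under eq_bigr do rewrite mxE; rewrite -mulr_suml divff// gt_eqF.
pose A : 'M[R]_(n.+1, d) := \matrix_i ((enorm (y i))^-1 *: y i).
have rowA i : row i A = (enorm (y i))^-1 *: y i by rewrite rowK.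
have lamA : lam *m A = 0.
  rewrite mulmx_sum_row; under eq_bigr => i _.
    rewrite rowA mxE scalerA (_ : _ *: _ = L^-1 *: y i); first over.
    have [->|yi0] := eqVneq (y i) 0; first by rewrite !scaler0.
    by rewrite mulrAC divff ?mul1r// enorm_eq0.
  by rewrite -scaler_sumr y0 scaler0.
have dotA i : dot (row i A) (row i A) = (y i != 0)%:R.
  rewrite rowA; have [->|yi0] := eqVneq (y i) 0; first by rewrite scaler0 dot0l.
  rewrite dotZl dotZr -sqr_enorm -[RHS]/(1 : R); field.
  by rewrite enorm_eq0.
have spread_lam : spread A lam = 1.
  rewrite /spread lamA dot0l subr0 -lams.2; apply: eq_bigr => i _.
  rewrite dotA mxE; have [->|_] := eqVneq (y i) 0; last by rewrite mulr1.
  by rewrite enorm0 !mul0r.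
have spread_le (mu : 'rV_n.+1) : in_simplex mu ->
    spread A mu <= 1 - dot (mu *m A) (mu *m A).
  move=> [mu0 mu1]; rewrite lerB// -mu1; apply: ler_sum => i _.
  by rewrite dotA ler_piMr// lern1 leq_b1.
(* A [t] strictly above [rho] leaves the slack [t ^+ 2 - rho ^+ 2] for the approximation and is
   positive even when [rho = 0]. *)
suff bound t : rho < t -> \sum_i h i <= t * L.
  apply/ler_addgt0Pr => eps eps0.
  have := bound (rho + eps / L); rewrite ltrDl divr_gt0// mulrDl.
  by rewrite divfK ?gt_eqF//; exact.
move=> rhot; have t0 : 0 < t by exact: le_lt_trans rhot.
pose D i := (enorm (y i))^-1 * h i.
(* With the factor [2 * t] the final inequality completes to the square of [enorm x - t], where [x]
   is the mean under [mu]. *)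
pose f : 'rV[R]_n.+1 := \row_i (2 * t * (dot (row i A) b - D i)).
have dotf (mu : 'rV_n.+1) : dot f mu =
    2 * t * (dot (mu *m A) b - \sum_i mu ord0 i * D i).
  rewrite mulmx_sum_row dot_suml -sumrB mulr_sumr [LHS]/dot.
  by apply: eq_bigr => i _; rewrite mxE dotZl; ring.
have delta0 : 0 < t ^+ 2 - rho ^+ 2 by rewrite subr_gt0 ltr_pXn2r// nnegrE ltW.
have [mu [mus muk]] := sparse_point_approx A f k0 kn lams delta0.
have [|J muJ Jk] := card_superset muk; first by rewrite card_ord.
rewrite !dotf lamA dot0l spread_lam -rho2.
set x := mu *m A; have /spread_le := mus; rewrite -/x.
have muD : \sum_i mu ord0 i * D i <= dot x b + enorm x.
  apply: (@le_trans _ _ (dot x (p J))).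
    rewrite /x mulmx_sum_row dot_suml; apply: ler_sum => i _.
    have [->|mui] := eqVneq (mu ord0 i) 0; first by rewrite mul0r scale0r dot0l.
    rewrite dotZl ler_wpM2l ?mus.1// rowA dotZl
      ler_wpM2l ?invr_ge0 ?enorm_ge0//.
    by apply: hp => //; apply: (fintype.subsetP muJ); rewrite inE.
  rewrite -[p J](subrK b) dotDr addrC lerD2l.
  apply: le_trans (dot_le_enorm _ _) _.
  by rewrite ler_piMr ?enorm_ge0// pb.
have lamD : (\sum_i h i) / L <= \sum_i lam ord0 i * D i.
  rewrite mulr_suml; apply: ler_sum => i _; rewrite mxE /D.
  have [yi0|yi0] := eqVneq (y i) 0.
    by rewrite yi0 enorm0 !mul0r pmulr_lle0 ?invr_gt0// h_le0.
  rewrite mulrAC mulrA divff ?mul1r// enorm_eq0//.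
rewrite -sqr_enorm -ler_pdivrMr// => spx ineq.
apply: le_trans lamD _.
move: muD spx ineq; move: (\sum_i mu _ _ * _) (\sum_i lam _ _ * _) (dot x b).
move: (spread A mu) (enorm x) => s e Dm Dl xb muD spx ineq.
have : 0 <= (e - t) ^+ 2 by exact: sqr_ge0.
have : 0 <= 2 * t * (xb + e - Dm)
  by rewrite mulr_ge0 ?subr_ge0// mulr_ge0// ltW.
move=> h1 h2; rewrite -(@ler_pM2l _ (2 * t)) ?mulr_gt0//.
nra.
Qed.

(* Opened only here: above, [set i | _] denotes a finite set. *)
Local Open Scope classical_set_scope.
Local Open Scope ring_scope.

(** * Compactness and continuity *)

Lemma entry_continuous (R : realType) d n (i : 'I_n) :
  continuous (fun v : 'rV['rV[R]_d]_n => v ord0 i).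
Proof.
move=> /= v s /= /(nbhs_ballP (v ord0 i)) [e e0 es].
by apply/nbhs_ballP; exists e => //= u [_ uv]; exact/es/uv.
Qed.

Lemma closed_approx (R : realType) d (D : set 'rV[R]_d) :
  (forall p, (forall eps, 0 < eps -> exists2 z, D z & enorm (p - z) <= eps) ->
    D p) -> closed D.
Proof.
move=> Dlim p clp; apply: Dlim => eps eps0.
(* The topology is entrywise: [d] squares of [eps / d.+1%:R] sum to at most [eps ^+ 2], and [d.+1]
   is nonzero even for [d = 0]. *)
have e0 : 0 < eps / d.+1%:R by rewrite divr_gt0.
have [z [Dz [_ pz]]] := clp _ (nbhsx_ballx p _ e0).
exists z => //; rewrite enorm_le ?(ltW eps0)//.
apply: (@le_trans _ _ (\sum_(i < d) (eps / d.+1%:R) ^+ 2)).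
  apply: ler_sum => i _; rewrite -expr2 -real_normK ?num_real//.
  rewrite lerXn2r ?nnegrE ?normr_ge0 ?(ltW e0)// ltW//.
  by have := pz ord0 i; rewrite /ball /= !mxE.
rewrite sumr_const card_ord -[leLHS]mulr_natr exprMn -mulrA ler_piMr ?sqr_ge0//.
rewrite exprVn mulrC ler_pdivrMr ?exprn_gt0// mul1r -natrX ler_nat.
by rewrite -mulnn (leq_trans (leqnSn d))// leq_pmulr.
Qed.

Lemma compact_enorm (R : realType) d (D : set 'rV[R]_d) b (r : R) :
  closed D -> (forall z, D z -> enorm (z - b) <= r) -> compact D.
Proof.
move=> clD Dr.
have segC : compact [set v : 'rV[R]_d |
    forall i, `[b ord0 i - r, b ord0 i + r]%classic (v ord0 i)].
  apply: (@rV_compact _ _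
    (fun i => `[b ord0 i - r, b ord0 i + r]%classic)) => i.
  exact: segment_compact.
apply: subclosed_compact clD segC _ => z /Dr zr i /=.
have r0 : 0 <= r := le_trans (enorm_ge0 _) zr.
move: zr; rewrite enorm_le// => zr; rewrite in_itv /= -ler_distl.
rewrite -(@ler_sqr R) ?nnegrE ?normr_ge0// real_normK ?num_real//.
apply: le_trans zr.
rewrite /dot (bigD1 i)//= !mxE -expr2 lerDl sumr_ge0// => j _.
by rewrite -expr2 sqr_ge0.
Qed.

Lemma sum_dot_continuous (R : realType) d n :
  continuous (fun v : 'rV['rV[R]_d]_n =>
    \sum_i dot (v ord0 i - n%:R^-1 *: \sum_j v ord0 j)
               (v ord0 i - n%:R^-1 *: \sum_j v ord0 j)).
Proof.
have coordC (i : 'I_n) (k : 'I_d) :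
    continuous (fun v : 'rV['rV[R]_d]_n => (v ord0 i : 'rV_d) ord0 k).
  move=> v; apply: (@continuous_comp _ _ _ (fun u : 'rV['rV[R]_d]_n => u ord0 i)
    (fun u : 'rV[R]_d => u ord0 k)); first exact: entry_continuous.
  exact: coord_continuous.
have sumC m (F : 'I_m -> 'rV['rV[R]_d]_n -> R) : (forall i, continuous (F i)) ->
    continuous (fun v => \sum_i F i v).
  move=> Fc v; apply: cvg_big => [||i _]; first exact: add_continuous.
    exact: nbhs_filter.
  exact: Fc.
have devC (i : 'I_n) (k : 'I_d) : continuous (fun v : 'rV['rV[R]_d]_n =>
    (v ord0 i - n%:R^-1 *: \sum_j v ord0 j) ord0 k).
  have -> : (fun v : 'rV['rV[R]_d]_n =>
        (v ord0 i - n%:R^-1 *: \sum_j v ord0 j) ord0 k) =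
      (fun v : 'rV['rV[R]_d]_n => (v ord0 i : 'rV[R]_d) ord0 k -
        n%:R^-1 * \sum_j (v ord0 j : 'rV[R]_d) ord0 k).
    by apply/funext => v; rewrite !mxE summxE.
  move=> v; apply: (cvgB (coordC i k v)).
  apply: (cvgM (cvg_cst _)).
  exact: (sumC _ (fun j (u : 'rV['rV[R]_d]_n) => (u ord0 j : 'rV[R]_d) ord0 k)).
apply: (sumC _ (fun i v => dot _ _)) => i.
apply: (sumC _ (fun k v => _ * _)) => k v.
exact: (cvgM (devC i k v) (devC i k v)).
Qed.

(** * Minimising the variance *)

Lemma sum_dot_mean (R : realType) d n (y : 'I_n -> 'rV[R]_d) (s : 'rV[R]_d) :
  \sum_i y i = 0 ->
  \sum_i dot (y i - s) (y i - s) = \sum_i dot (y i) (y i) + n%:R * dot s s.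
Proof.
move=> y0; have ys : \sum_i dot (y i) s = 0 by rewrite -dot_suml y0 dot0l.
have E i : dot (y i - s) (y i - s) =
    dot (y i) (y i) - 2 * dot (y i) s + dot s s.
  by rewrite !dot_lin (dotC s (y i)); ring.
under eq_bigr do rewrite E.
rewrite big_split sumrB -mulr_sumr ys mulr0 subr0 sumr_const card_ord /=.
by rewrite mulr_natl.
Qed.

(* The last conjunct is the first-order condition for [v] to minimise the
   variance over the product of the [D i]. *)
Lemma spread_minimizer (R : realType) d n (D : 'I_n.+1 -> set 'rV[R]_d) :
    (forall i, compact (D i)) -> (forall i, convex_set (D i)) ->
    (forall i, D i !=set0) ->
  exists (v : 'I_n.+1 -> 'rV[R]_d) (c : 'rV[R]_d),
    [/\ forall i, D i (v i), \sum_i (v i - c) = 0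
      & forall i z, D i z -> 0 <= dot (v i - c) (z - v i)].
Proof.
move=> Dc Dconv D0.
pose mean (v : 'rV['rV[R]_d]_n.+1) := n.+1%:R^-1 *: \sum_j v ord0 j.
pose F (v : 'rV['rV[R]_d]_n.+1) :=
  \sum_i dot (v ord0 i - mean v) (v ord0 i - mean v).
pose P := [set v : 'rV['rV[R]_d]_n.+1 | forall i, D i (v ord0 i)].
have P0 : P !=set0.
  have /choice[w Dw] := D0.
  by exists (\row_i w i) => i; rewrite mxE.
have [v /set_mem Pv vmin] := compact_EVT_min P0 (rV_compact Dc)
  (continuous_subspaceT (@sum_dot_continuous R d n.+1)).
pose c := mean v.
have dev0 (u : 'rV['rV[R]_d]_n.+1) : \sum_i (u ord0 i - mean u) = 0.
  rewrite sumrB sumr_const card_ord /mean -scaler_nat scalerA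
    divff ?pnatr_eq0//.
  by rewrite scale1r subrr.
exists (fun i => v ord0 i), c; split=> // i z Dz.
set y := v ord0 i - c; set e := z - v ord0 i.
have var t : 0 < t -> t <= 1 -> 0 <= 2 * dot y e + t * dot e e.
  move=> t0 t1.
  pose u : 'rV['rV[R]_d]_n.+1 :=
    \row_j (if j == i then v ord0 i + t *: e else v ord0 j).
  have Pu : P u.
    move=> j; rewrite mxE; case: eqP => [->|_]; last exact: Pv.
    rewrite (_ : _ + _ = (1 - t) *: v ord0 i + t *: z).
      exact: (Dconv i _ _ (Pv i) Dz t (ltW t0) t1).
    by rewrite /e scalerBl scalerBr scale1r addrA addrAC.
  (* Deviations of [u] are measured from the old mean [c]. By [sum_dot_mean] this can only increase
     the sum, and then only the term at [i] differs from [F v]. *)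
  have Fu : F v <= \sum_j dot (u ord0 j - c) (u ord0 j - c).
    apply: le_trans (vmin u (mem_set Pu)) _.
    have -> : \sum_j dot (u ord0 j - c) (u ord0 j - c) =
        F u + n.+1%:R * dot (c - mean u) (c - mean u).
      rewrite -(sum_dot_mean _ (dev0 u)); apply: eq_bigr => j _.
      by rewrite opprB addrA subrK.
    by rewrite lerDl mulr_ge0 ?dot_ge0.
  move: Fu; rewrite /F -/c (bigD1 i)//= [leRHS](bigD1 i)//=.
  rewrite [X in _ <= _ + X](eq_bigr (fun j =>
    dot (v ord0 j - c) (v ord0 j - c))); last first.
    by move=> j /negbTE ji; rewrite mxE ji.
  rewrite lerD2r mxE eqxx addrAC -/y.
  have -> : dot (y + t *: e) (y + t *: e) =
      dot y y + t * (2 * dot y e + t * dot e e).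
    move: (y) (e) => a a'.
    by rewrite !(dotDl, dotDr) !dotZl !dotZr (dotC a' a); ring.
  by rewrite lerDl pmulr_rge0.
rewrite leNgt; apply/negP => ye.
have [ee0|ee0] := eqVneq (dot e e) 0.
  by have := var 1 ltr01 (lexx _); rewrite ee0 mulr0; lra.
have {}ee0 : 0 < dot e e by rewrite lt_def ee0 dot_ge0.
(* The minimiser of the quadratic in [t]; if it exceeds 1, then [t = 1] already gives a
   contradiction. *)
have t0 : 0 < - dot y e / dot e e by rewrite divr_gt0// oppr_gt0.
have [t1|t1] := leP (- dot y e / dot e e) 1.
  by have := var _ t0 t1; rewrite divfK ?gt_eqF//; lra.
have := var 1 ltr01 (lexx _); rewrite mul1r => h.
by move: t1; rewrite ltr_pdivlMr// mul1r; lra.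
Qed.

(** * Distance to a set *)

Section Edist.
Context {R : realType} {d : nat}.
Implicit Types (q x : 'rV[R]_d) (K : set 'rV[R]_d).

Lemma edist_le q x K : K x -> edist q K <= enorm (q - x).
Proof.
move=> Kx; apply: ge_inf; last by exists x.
by exists 0 => _ [z _ <-]; exact: enorm_ge0.
Qed.

(** Nearest points may fail to exist, hence the [eps]. Nonemptiness matters because [inf] of the
    empty set is 0. *)
Lemma edist_leP q K (r : R) : K !=set0 ->
  edist q K <= r <->
  forall eps, 0 < eps -> exists2 x, K x & enorm (q - x) <= r + eps.
Proof.
move=> [x0 Kx0]; split=> [qr eps eps0|approx].
  have : edist q K < r + eps by rewrite (le_lt_trans qr)// ltrDl.
  case/inf_lt => [|_ [x Kx <-] /ltW]; last by exists x.
  by exists (enorm (q - x0)), x0.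
apply/ler_addgt0Pr => eps /approx[x Kx]; apply: le_trans; exact: edist_le.
Qed.

Lemma edist_ball_convex K b r s :
  K !=set0 -> convex_set K ->
  convex_set [set z | enorm (z - b) <= s /\ edist z K <= r].
Proof.
move=> K0 Kconv x y [xb xK] [yb yK] t t0 t1; split.
  have -> : (1 - t) *: x + t *: y - b = (1 - t) *: (x - b) + t *: (y - b).
    by apply/rowP => i; rewrite !mxE; ring.
  apply: le_trans (enormD _ _) _; rewrite !enormZ !ger0_norm ?subr_ge0//.
  have : (1 - t) * enorm (x - b) <= (1 - t) * s by rewrite ler_wpM2l ?subr_ge0.
  have : t * enorm (y - b) <= t * s by rewrite ler_wpM2l.
  lra.
apply/(edist_leP _ _ K0) => eps eps0.
move/(edist_leP _ _ K0)/(_ _ eps0): xK => [x' Kx' xx'].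
move/(edist_leP _ _ K0)/(_ _ eps0): yK => [y' Ky' yy'].
exists ((1 - t) *: x' + t *: y'); first exact: Kconv.
have -> : (1 - t) *: x + t *: y - ((1 - t) *: x' + t *: y') =
    (1 - t) *: (x - x') + t *: (y - y') by rewrite !scalerBr opprD addrACA.
apply: le_trans (enormD _ _) _; rewrite !enormZ !ger0_norm ?subr_ge0//.
have : (1 - t) * enorm (x - x') <= (1 - t) * (r + eps).
  by rewrite ler_wpM2l ?subr_ge0.
have : t * enorm (y - y') <= t * (r + eps) by rewrite ler_wpM2l.
lra.
Qed.

(** The ball gives boundedness, and bounding the distance to [K] instead of asking for membership
    gives closedness. *)
Lemma edist_ball_compact K b r s :
  K !=set0 -> compact [set z | enorm (z - b) <= s /\ edist z K <= r].
Proof.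
move=> K0; apply: (@compact_enorm _ _ _ b s) => [|z [] //].
apply: closed_approx => p approx; split.
  apply/ler_addgt0Pr => eps /approx[z [zb _] pz].
  rewrite -(subrK z p) -addrA addrC; apply: le_trans (enormD _ _) _.
  exact: lerD.
apply/(edist_leP _ _ K0) => eps eps0.
have eps2 : 0 < eps / 2 by rewrite divr_gt0.
have [z [_ /(edist_leP _ _ K0)/(_ _ eps2)[x Kx zx]] pz] := approx _ eps2.
exists x => //; rewrite -(subrK z p) -addrA; apply: le_trans (enormD _ _) _.
lra.
Qed.

End Edist.

(** * The common point, from the minimiser and the dual inequality *)

Theorem theorem5p1 (R : realType) (d n k : nat) (K : 'I_n -> set 'rV[R]_d)
  (b : 'rV[R]_d) :
  (2 <= n)%N -> (1 <= k)%N -> (k <= n)%N ->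
  (forall i, convex_set (K i)) ->
  (forall J : {set 'I_n}, #|J| = k -> cball b 1 `&` Kint K J !=set0) ->
  exists q : 'rV[R]_d, forall i : 'I_n,
    edist q (K i) <= Num.sqrt ((n - k)%:R / (k * (n - 1))%:R).
Proof.
case: n K => [//|n] K _ k0 kn Kconv KJ.
rewrite -/(radius2 R n.+1 k); set rho := Num.sqrt _.
have rho0 : 0 <= rho by exact: sqrtr_ge0.
have /choice[p pP] : forall J : {set 'I_n.+1}, exists x : 'rV[R]_d,
    #|J| = k -> (cball b 1 `&` Kint K J) x.
  move=> J.
  have [/KJ[x Jx]|Jk] := eqVneq #|J| k; first by exists x.
  by exists b => /eqP; rewrite (negPf Jk).
have cover i : exists2 J : {set 'I_n.+1}, i \in J & #|J| = k.
  have [||J] := @card_superset _ [set i]%SET k; rewrite ?cards1 ?card_ord//.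
  by rewrite finset.sub1set; exists J.
have K0 i : K i !=set0.
  by have [J iJ /pP[_ /(_ i iJ)]] := cover i; exists (p J).
(* The radius [1 + rho] keeps every [p J + u] with [enorm u <= rho] inside the ball. *)
pose D i := [set z | enorm (z - b) <= 1 + rho /\ edist z (K i) <= rho].
have Dp i (J : {set 'I_n.+1}) (u : 'rV[R]_d) :
    i \in J -> #|J| = k -> enorm u <= rho -> D i (p J + u).
  move=> iJ /pP[pJ /(_ i iJ) Kp] u_le; split.
    by rewrite addrAC; apply: le_trans (enormD _ _) _; exact: lerD.
  by apply: le_trans (edist_le _ Kp) _; rewrite addrC addKr.
have [||i|v [c [Dv yc0 vmin]]] := @spread_minimizer _ _ _ D.
- by move=> i; exact: edist_ball_compact.
- by move=> i; exact: edist_ball_convex.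
- by have [J iJ Jk] := cover i; exists (p J + 0); apply: Dp; rewrite ?enorm0.
pose y i := v i - c.
have ineq : \sum_i (dot (y i) (v i) + rho * enorm (y i)) <=
    rho * \sum_i enorm (y i).
  apply: (@dual_bound _ _ _ _ y p b) => // [J /pP[]//|J i Jk iJ].
  (* The displacement of length at most [rho] that minimises the inner product with [y i]; it is 0
     when [y i = 0]. *)
  pose u := - (rho / enorm (y i)) *: y i.
  have u_le : enorm u <= rho.
    rewrite enormZ normrN ger0_norm ?divr_ge0 ?enorm_ge0//.
    have [->|y0] := eqVneq (enorm (y i)) 0; first by rewrite mulr0.
    by rewrite divfK.
  have := vmin i _ (Dp i J u iJ Jk u_le); rewrite -/(y i).
  rewrite !(dotDr, dotNr) dotZr -sqr_enorm.
  have -> : - (rho / enorm (y i)) * enorm (y i) ^+ 2 = - (rho * enorm (y i)).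
    have [->|y0] := eqVneq (enorm (y i)) 0.
      by rewrite expr0n !mulr0 oppr0.
    by field.
  lra.
(* In [ineq] the terms with [rho] cancel, so the [dot (y i) (v i)] sum to at most 0. As the [y i]
   sum to 0, that sum is also the sum of their squared norms. *)
have y0 i : y i = 0.
  apply/eqP; rewrite -dot_eq0; apply/eqP; move: (i) isT.
  apply: psumr_eq0P => [j _|]; first exact: dot_ge0.
  apply/le_anti/andP; split; last by apply: sumr_ge0 => j _; exact: dot_ge0.
  have : \sum_j dot (y j) c = 0 by rewrite -dot_suml yc0 dot0l.
  move: ineq; rewrite big_split /= -mulr_sumr gerDr => yv yc.
  under eq_bigr do rewrite {2}/y dotDr dotNr.
  by rewrite sumrB yc subr0.
exists c => i; have [_] := Dv i.
by have /eqP := y0 i; rewrite subr_eq0 => /eqP ->.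
Qed.
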